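(* Let $\mathcal{M}'_a: z(u,v)=f(u)\,l(v)+g(u)\,e_4$, $u\in I$, $v\in J$, be a meridian surface of type $\mathcal{M}'_a$ in $\mathbb{E}^4_2$ (so $l$ is a unit-speed spacelike curve on $\mathbb{S}^2_1(1)$ and $f'^2-g'^2=-1$). Then $\mathcal{M}'_a$ is minimal if and only if the curve $l$ has zero spherical curvature ($\kappa\equiv 0$ on $J$) and the meridian curve $u\mapsto(f(u),g(u))$ is given on $I$ by $$f(u)=\pm\sqrt{-u^2+2au+b},\qquad g(u)=\pm\sqrt{a^2+b}\,\arcsin\frac{u-a}{\sqrt{a^2+b}}+C,$$ for some real constants $a,b,C$ and some choice of the two (independent) signs.
   Context: $\mathbb{E}^4_2$ is $\mathbb{R}^4$ with the inner product $\langle x,y\rangle=x_1y_1+x_2y_2-x_3y_3-x_4y_4$ and standard basis $e_1,e_2,e_3,e_4$. A vector $v$ is spacelike if $\langle v,v\rangle>0$ or $v=0$, timelike if $\langle v,v\rangle<0$, lightlike if $\langle v,v\rangle=0$ and $v\ne0$. Let $\mathbb{E}^3_1=\mathrm{span}\{e_1,e_2,e_3\}$ and $\mathbb{S}^2_1(1)=\{V\in\mathbb{E}^3_1:\langle V,V\rangle=1\}$. Meridian surface of type $\mathcal{M}'_a$: let $I,J\subset\mathbb{R}$ be open intervals, $f,g:I\to\mathbb{R}$ smooth with $f$ nowhere zero and $f'^2-g'^2=-1$, and $l:J\to\mathbb{S}^2_1(1)$ a smooth curve with $\langle l',l'\rangle=1$. The surface is $z(u,v)=f(u)l(v)+g(u)e_4$.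 Its induced metric is Lorentzian, with orthonormal tangent frame $X=z_u$, $Y=z_v/f=l'$, $\langle X,X\rangle=-1$, $\langle Y,Y\rangle=1$. Spherical curvature: put $t=l'$ and let $n$ be a smooth vector field along $l$ (unique up to sign) such that $\{l,t,n\}$ is an orthonormal frame of $\mathbb{E}^3_1$ with $\langle n,n\rangle=-1$; then $\kappa(v)=\langle t'(v),n(v)\rangle$, so that $t'=-\kappa n-l$, $n'=-\kappa t$. For a Lorentz surface with second fundamental form $h$, the mean curvature vector field is $H=\tfrac12\,\mathrm{tr}\,h=\tfrac12\left(h(E_1,E_1)-h(E_2,E_2)\right)$ for any local orthonormal tangent frame with $\langle E_1,E_1\rangle=1$, $\langle E_2,E_2\rangle=-1$. The surface is minimal if $H=0$ identically. *)

(* Defs.v *)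
From HB Require Import structures.
From mathcomp Require Import all_boot all_order all_algebra.
From mathcomp Require Import all_classical all_reals all_analysis.
Set Implicit Arguments.
Unset Strict Implicit.
Unset Printing Implicit Defensive.
Import Order.TTheory GRing.Theory Num.Theory.
Import numFieldNormedType.Exports.
Local Open Scope ring_scope.
Local Open Scope classical_set_scope.

Section Defs.
Variable R : realType.

(* The pseudo-Euclidean space E^4_2 has carrier 'rV[R]_4; the coordinates
   x_1, ..., x_4 are x 0 0, ..., x 0 3, and e_1, ..., e_4 are basis_vec 0, ...,
   basis_vec 3. *)
Definition inner (x y : 'rV[R]_4) : R :=
  x 0 0 * y 0 0 + x 0 1 * y 0 1 - x 0 2 * y 0 2 - x 0 3 * y 0 3.

Definition basis_vec (i : 'I_4) : 'rV[R]_4 := delta_mx 0 i.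

Definition E31 : set 'rV[R]_4 :=
  [set x | exists a b c : R,
     x = a *: basis_vec 0 + b *: basis_vec 1 + c *: basis_vec 2].

Definition S21 : set 'rV[R]_4 := [set x | E31 x /\ inner x x = 1].

(* Intended for an open set D, since the derivatives are two-sided. *)
Definition smooth_on (V : normedModType R) (D : set R) (f : R -> V) : Prop :=
  forall (k : nat) (x : R), D x -> derivable (derive1n k f) x 1.

Definition open_interval (D : set R) : Prop :=
  [/\ open D, is_interval D & D !=set0].

(* For z : R -> R -> 'rV[R]_4 seen as a parametrized surface (u, v) |-> z u v,
   a pair p stands for the tangent vector p.1 z_u + p.2 z_v, which is
   dirD p z u v. *)
Definition dirD (p : R * R) (w : R -> R -> 'rV[R]_4) (u v : R) : 'rV[R]_4 :=
  p.1 *: derive1 (fun s => w s v) u + p.2 *: derive1 (fun s => w u s) v.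

Definition tangent (z : R -> R -> 'rV[R]_4) (u v : R) : set 'rV[R]_4 :=
  [set x | exists p : R * R, x = dirD p z u v].

(* The y normal to T with w - y in T; it is unique when the metric is
   nondegenerate on T. *)
Definition normal_part (T : set 'rV[R]_4) (w : 'rV[R]_4) : 'rV[R]_4 :=
  xget 0 [set y | (forall t, T t -> inner y t = 0) /\ T (w - y)].

(* Gauss formula: h(X, Y) is the normal component of the flat derivative of Y
   along X.  As h is tensorial, the tangent vector q is extended to the tangent
   field with constant coefficients, dirD q z. *)
Definition second_ff (z : R -> R -> 'rV[R]_4) (u v : R) (p q : R * R) :
    'rV[R]_4 :=
  normal_part (tangent z u v) (dirD p (dirD q z) u v).

Definition orthonormal_frame (z : R -> R -> 'rV[R]_4) (u v : R)
    (p q : R * R) : Prop :=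
  [/\ inner (dirD p z u v) (dirD p z u v) = 1,
      inner (dirD q z u v) (dirD q z u v) = -1 &
      inner (dirD p z u v) (dirD q z u v) = 0].

(* The first conjunct says that the induced metric is Lorentzian at (u, v), so
   that the second one is not vacuous. *)
Definition is_mean_curvature (z : R -> R -> 'rV[R]_4) (u v : R)
    (H : 'rV[R]_4) : Prop :=
  (exists p q : R * R, orthonormal_frame z u v p q) /\
  (forall p q : R * R, orthonormal_frame z u v p q ->
     H = 2^-1 *: (second_ff z u v p p - second_ff z u v q q)).

Definition minimal (I J : set R) (z : R -> R -> 'rV[R]_4) : Prop :=
  forall u v : R, I u -> J v -> is_mean_curvature z u v 0.

Definition meridian_surface (f g : R -> R) (l : R -> 'rV[R]_4) (u v : R) :
    'rV[R]_4 :=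
  f u *: l v + g u *: basis_vec 3.

Definition unit_speed_on_S21 (J : set R) (l : R -> 'rV[R]_4) : Prop :=
  [/\ smooth_on J l, forall v, J v -> S21 (l v) &
      forall v, J v -> inner (derive1 l v) (derive1 l v) = 1].

(* For such an l, n completes l, l' to an orthonormal frame of E^3_1; the
   relations among l and l' follow from unit_speed_on_S21. *)
Definition unit_normal (J : set R) (l n : R -> 'rV[R]_4) : Prop :=
  smooth_on J n /\
  forall v, J v ->
    [/\ E31 (n v), inner (n v) (n v) = -1, inner (n v) (l v) = 0 &
        inner (n v) (derive1 l v) = 0].

Definition spherical_curvature (l n : R -> 'rV[R]_4) (v : R) : R :=
  inner (derive1n 2 l v) (n v).

End Defs.

(* Main.v *)
Require Import Defs.
From HB Require Import structures.
From mathcomp Require Import all_boot all_order all_algebra.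
From mathcomp Require Import ring lra.
From mathcomp Require Import all_classical all_reals all_analysis.
Import Order.TTheory GRing.Theory Num.Theory.
Import numFieldNormedType.Exports.
Local Open Scope ring_scope.
Local Open Scope classical_set_scope.

(* In the orthonormal tangent frame z_u, z_v / f, the surface is minimal iff
   w = z_vv / f^2 - z_uu = l'' / f - f'' l - g'' e_4 is tangent.  The normal plane
   is spanned by n and g' l + f' e_4, and l'' = - kappa n - l, so this means
   kappa = 0 and g'' f' - f'' g' = g' / f.  As g'^2 = f'^2 + 1 never vanishes, the
   second equation is equivalent to f f'' + f'^2 + 1 = 0, that is (f^2)'' = -2,
   whence f^2 = - u^2 + 2 a u + b and f f' = a - u.  Then
   g'^2 = 1 + f'^2 = (a^2 + b) / f^2, which integrates to the arcsine. *)

(** * Calculus of one real variable: derivatives on open sets and constancy of sign *)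

Section OneVariable.
Context {R : realType}.

Lemma is_derive_derive1 {V : normedModType R} (f : R -> V) (x : R) d :
  is_derive x 1 f d -> derive1 f x = d.
Proof. by move=> h; rewrite derive1E derive_val. Qed.

Lemma smooth_is_derive {V : normedModType R} D (f : R -> V) k (x : R) :
  smooth_on D f -> D x ->
  is_derive x 1 (derive1n k f) (derive1n k.+1 f x).
Proof. by move=> fD Dx; rewrite derive1nS derive1E; exact/derivableP/fD. Qed.

Lemma is_derive_open_eq {V : normedModType R} (D : set R) (f g : R -> V) (x : R) d :
  open D -> D x -> (forall y, D y -> f y = g y) ->
  is_derive x 1 g d -> is_derive x 1 f d.
Proof.
move=> oD Dx fg; apply: near_eq_is_derive.
apply: (@filterS _ _ _ D); first by move=> y /fg.
by apply: open_nbhs_nbhs; split.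
Qed.

Lemma is_derive_open_unique {V : normedModType R} (D : set R)
    (f g : R -> V) (x : R) a b :
  open D -> D x -> (forall y, D y -> f y = g y) ->
  is_derive x 1 f a -> is_derive x 1 g b -> a = b.
Proof.
move=> oD Dx fg fa gb.
rewrite -(is_derive_derive1 _ _ _ fa); apply: is_derive_derive1.
exact: (is_derive_open_eq _ _ _ _ _ oD Dx fg gb).
Qed.

Lemma is_derive_scalel {V : normedModType R} (f : R -> R) (w : V) (x : R) d :
  is_derive x 1 f d -> is_derive x 1 (fun s => f s *: w) (d *: w).
Proof.
move=> [/derivable1_diffP fx <-]; apply: DeriveDef.
  exact/diff_derivable/differentiableZl.
rewrite deriveE; last exact: differentiableZl.
by rewrite diffZl// deriveE.
Qed.

Lemma is_derive_coord {m k} (M : R -> 'M[R]_(m, k)) (x : R) dM i j :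
  is_derive x 1 M dM -> is_derive x 1 (fun s => M s i j) (dM i j).
Proof.
move=> [Mx <-]; rewrite derive_mx// mxE.
by apply: derivableP; move/derivable_mxP : Mx; apply.
Qed.

Lemma is_derive_inner (x y : R -> 'rV[R]_4) dx dy (t : R) :
  is_derive t 1 x dx -> is_derive t 1 y dy ->
  is_derive t 1 (fun s => inner (x s) (y s)) (inner dx (y t) + inner (x t) dy).
Proof.
move=> hx hy.
have X i := is_derive_coord x t dx 0 i hx.
have Y i := is_derive_coord y t dy 0 i hy.
have XY i := is_deriveM (X i) (Y i).
(* Rewritten with products and sums of functions, the form to which the derivative rules apply. *)
have -> : (fun s => inner (x s) (y s)) =
  ((fun s => x s 0 0) * (fun s => y s 0 0) + (fun s => x s 0 1) * (fun s => y s 0 1)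
   - (fun s => x s 0 2) * (fun s => y s 0 2) - (fun s => x s 0 3) * (fun s => y s 0 3)) by [].
apply: is_derive_eq.
by rewrite /inner /GRing.scale/=; ring.
Qed.

Lemma derive0_interval (D : set R) (f : R -> R) :
  is_interval D -> (forall x, D x -> is_derive x 1 f 0) ->
  forall x y, D x -> D y -> f x = f y.
Proof.
move=> iD df x y; wlog xy : x y / x <= y => [H Dx Dy|Dx Dy].
  by case: (leP x y) => [|/ltW] /H -> .
have Dz z : z \in `[x, y]%R -> D z by rewrite in_itv/=; exact: iD.
have [z zxy|z|z _] := @MVT_segment _ f (fun=> 0) x y xy.
- by apply/df/Dz; exact: subset_itv_oo_cc.
- apply: (@derivable_within_continuous _ _ f `[x, y]%R) => t /Dz /df.
  by case.
- by rewrite mul0r => /eqP; rewrite subr_eq0 => /eqP.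
Qed.

(** By the intermediate value theorem a change of sign would force a zero, so the sign at one point
    serves for all of [D]. Applied to f and to g', this yields the two independent signs of the
    theorem. *)
Lemma nonvanishing_sign (D : set R) (f : R -> R) :
  is_interval D -> (forall x, D x -> derivable f x 1) ->
  (forall x, D x -> f x <> 0) ->
  exists s : bool, forall x, D x -> f x = (-1) ^+ s * `|f x|.
Proof.
move=> iD df f0.
have [[x0 Dx0]|D0] := pselect (D !=set0); last first.
  by exists false => x Dx; exfalso; apply: D0; exists x.
exists (f x0 < 0) => x Dx.
suff -> : (f x0 < 0) = (f x < 0).
  by case: ltP => [/ltr0_norm|/ger0_norm] ->; rewrite ?expr1 ?expr0; ring.
suff key a b : D a -> D b -> f a < 0 -> f b < 0.
  by apply/idP/idP; apply: key.
move=> Da Db fa; rewrite ltNge; apply/negP => fb.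
(* The order of [a] and [b] is unknown, so the intermediate value theorem is applied between their
   minimum and maximum. *)
have Dz z : z \in `[Num.min a b, Num.max a b]%R -> D z.
  rewrite in_itv/=; apply: iD; first by rewrite /Num.min; case: ifP.
  by rewrite /Num.max; case: ifP.
have [|||z zab fz] := @IVT _ f (Num.min a b) (Num.max a b) 0.
- by rewrite ge_min !le_max !lexx.
- by apply: (@derivable_within_continuous _ _ f) => t /Dz /df.
- rewrite ge_min le_max /Num.min /Num.max; case: ifP => _.
    by rewrite (ltW fa) fb orbT.
  by rewrite (ltW fa) fb orbT.
- by apply: (f0 z) => //; exact: Dz.
Qed.
End OneVariable.

(** * The indefinite inner product, nondegeneracy and normal projections *)

Section Inner.
Context {R : realType}.
Implicit Types (x y z : 'rV[R]_4) (a : R).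

Lemma innerC x y : inner x y = inner y x.
Proof. by rewrite /inner; ring. Qed.

Lemma innerDl x y z : inner (x + y) z = inner x z + inner y z.
Proof. by rewrite /inner !mxE; ring. Qed.

Lemma innerZl a x y : inner (a *: x) y = a * inner x y.
Proof. by rewrite /inner !mxE; ring. Qed.

Lemma innerNl x y : inner (- x) y = - inner x y.
Proof. by rewrite -scaleN1r innerZl mulN1r. Qed.

Lemma innerDr x y z : inner x (y + z) = inner x y + inner x z.
Proof. by rewrite !(innerC x) innerDl. Qed.

Lemma innerZr a x y : inner x (a *: y) = a * inner x y.
Proof. by rewrite !(innerC x) innerZl. Qed.

Lemma innerNr x y : inner x (- y) = - inner x y.
Proof. by rewrite !(innerC x) innerNl. Qed.

Definition innerE := (innerDl, innerDr, innerNl, innerNr, innerZl, innerZr).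

Lemma inner_basis_vec3 x : inner x (basis_vec R 3) = - x 0 3.
Proof. by rewrite /inner !mxE/=; ring. Qed.

Lemma E31P x : E31 x <-> x 0 3 = 0.
Proof.
split=> [[a [b [c ->]]]|x3]; first by rewrite !mxE/=; ring.
exists (x 0 0), (x 0 1), (x 0 2); apply/rowP => i; rewrite !mxE/=.
by case: i => -[|[|[|[|//]]]] i4 /=; rewrite ?mulr1 ?mulr0 ?addr0 ?add0r//;
  rewrite -?x3; congr (x _ _); apply/val_inj.
Qed.

(** An orthonormal frame has determinant [d] with [d ^+ 2 = 1], so the linear system given by the
    last three equations is invertible. Cramer's rule writes [d] times each coordinate of [w] as a
    combination of the three inner products, with cofactors as coefficients. *)
Lemma E31_orthogonal_eq0 x y z w : E31 x -> E31 y -> E31 z -> E31 w ->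
  inner x x = 1 -> inner y y = 1 -> inner z z = -1 ->
  inner x y = 0 -> inner z x = 0 -> inner z y = 0 ->
  inner w x = 0 -> inner w y = 0 -> inner w z = 0 -> w = 0.
Proof.
move=> /E31P x3 /E31P y3 /E31P z3 /E31P w3.
rewrite /inner x3 y3 z3 w3 !mulr0 !subr0 => xx yy zz xy zx zy wx wy wz.
pose d := x 0 0 * (y 0 1 * z 0 2 - y 0 2 * z 0 1)
        - x 0 1 * (y 0 0 * z 0 2 - y 0 2 * z 0 0)
        + x 0 2 * (y 0 0 * z 0 1 - y 0 1 * z 0 0).
have d2 : d ^+ 2 = 1.
  (* The Gram determinant of x, y, z is - d ^+ 2. *)
  set xx' := LHS in xx; set yy' := LHS in yy; set zz' := LHS in zz.
  set xy' := LHS in xy; set zx' := LHS in zx; set zy' := LHS in zy.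
  have -> : d ^+ 2 = - (xx' * (yy' * zz' - zy' ^+ 2)
    - xy' * (xy' * zz' - zy' * zx') + zx' * (xy' * zy' - yy' * zx')).
    by rewrite /d /xx' /yy' /zz' /xy' /zx' /zy'; ring.
  by rewrite xx yy zz xy zx zy; ring.
have d0 : d != 0 by rewrite -sqrf_eq0 d2 oner_eq0.
set wx' := LHS in wx; set wy' := LHS in wy; set wz' := LHS in wz.
have w0 : w 0 0 = 0.
  apply: (mulfI d0); rewrite mulr0.
  transitivity ((y 0 1 * z 0 2 - y 0 2 * z 0 1) * wx'
    - (x 0 1 * z 0 2 - x 0 2 * z 0 1) * wy'
    + (x 0 1 * y 0 2 - x 0 2 * y 0 1) * wz').
    by rewrite /d /wx' /wy' /wz'; ring.
  by rewrite wx wy wz; ring.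
have w1 : w 0 1 = 0.
  apply: (mulfI d0); rewrite mulr0.
  transitivity (- (y 0 0 * z 0 2 - y 0 2 * z 0 0) * wx'
    + (x 0 0 * z 0 2 - x 0 2 * z 0 0) * wy'
    - (x 0 0 * y 0 2 - x 0 2 * y 0 0) * wz').
    by rewrite /d /wx' /wy' /wz'; ring.
  by rewrite wx wy wz; ring.
have w2 : w 0 2 = 0.
  apply: (mulfI d0); rewrite mulr0.
  transitivity (- (y 0 0 * z 0 1 - y 0 1 * z 0 0) * wx'
    + (x 0 0 * z 0 1 - x 0 1 * z 0 0) * wy'
    - (x 0 0 * y 0 1 - x 0 1 * y 0 0) * wz').
    by rewrite /d /wx' /wy' /wz'; ring.
  by rewrite wx wy wz; ring.
apply/rowP => i; rewrite mxE.
by case: i => -[|[|[|[|//]]]] i4; [rewrite -w0|rewrite -w1|rewrite -w2|rewrite -w3];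
  congr (w _ _); apply/val_inj.
Qed.

Definition span2 x y : set 'rV[R]_4 :=
  [set w | exists p : R * R, w = p.1 *: x + p.2 *: y].

Lemma span2B x y w1 w2 : span2 x y w1 -> span2 x y w2 -> span2 x y (w1 - w2).
Proof.
move=> [p ->] [q ->]; exists (p.1 - q.1, p.2 - q.2) => /=.
by rewrite !scalerBl opprD addrACA.
Qed.

Lemma span2_normal x y w : span2 x y w -> forall z,
  inner x z = 0 -> inner y z = 0 -> inner w z = 0.
Proof. by move=> [p ->] z xz yz; rewrite !innerE xz yz; ring. Qed.

Lemma normal_partP x y w : inner x x = -1 -> inner x y = 0 -> inner y y != 0 ->
  [/\ inner (normal_part (span2 x y) w) x = 0,
      inner (normal_part (span2 x y) w) y = 0 &
      span2 x y (w - normal_part (span2 x y) w)].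
Proof.
move=> xx xy yy.
rewrite /normal_part; set P := (X in xget 0 X); set y0 := xget 0 P.
have : P y0.
  apply: (@xgetPex _ 0 P).
  (* Orthogonal projection off the plane, which shows that [xget] does not return its default. The
     term in [x] is added, not subtracted, because [inner x x = -1]. *)
  exists (w + inner w x *: x - (inner w y / inner y y) *: y); split; last first.
    exists (- inner w x, inner w y / inner y y) => /=.
    by apply/rowP => i; rewrite !mxE; ring.
  move=> t [p ->]; rewrite !innerE xx xy (innerC y x) xy.
  by field.
move=> [h ?]; split=> //; apply: h.
  by exists (1, 0) => /=; rewrite scale1r scale0r addr0.
by exists (0, 1) => /=; rewrite scale1r scale0r add0r.
Qed.

(** The difference of the two normal parts is normal to the plane and, when [w1 - w2] is tangent,
    also lies in it; the plane being nondegenerate, it vanishes. This turns the vanishing of H into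
    a tangency condition. *)
Lemma normal_part_eq x y w1 w2 :
  inner x x = -1 -> inner x y = 0 -> inner y y != 0 ->
  normal_part (span2 x y) w1 = normal_part (span2 x y) w2 <->
  span2 x y (w1 - w2).
Proof.
move=> xx xy yy.
have [x1 y1 s1] := normal_partP _ _ w1 xx xy yy.
have [x2 y2 s2] := normal_partP _ _ w2 xx xy yy.
move: x1 y1 s1 x2 y2 s2.
set n1 := normal_part _ w1; set n2 := normal_part _ w2 => x1 y1 s1 x2 y2 s2.
split=> [n12|s12].
  have -> : w1 - w2 = (w1 - n1) - (w2 - n2) by rewrite n12 opprB subrKA.
  exact: span2B.
have [p n12] : span2 x y (n1 - n2).
  have -> : n1 - n2 = (w1 - w2) - ((w1 - n1) - (w2 - n2)).
    by apply/rowP => i; rewrite !mxE; ring.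
  by apply: span2B => //; exact: span2B.
apply/eqP; rewrite -subr_eq0 n12; apply/eqP.
have := congr1 (fun t => inner t x) n12; rewrite !innerE x1 x2 xx (innerC y x) xy => p1.
have := congr1 (fun t => inner t y) n12; rewrite !innerE y1 y2 xy => p2.
have -> : p.1 = 0 by lra.
have /eqP : p.2 * inner y y = 0 by lra.
by rewrite mulf_eq0 (negbTE yy) orbF => /eqP ->; rewrite !scale0r addr0.
Qed.
End Inner.

(** * The moving frame of a unit-speed curve on the pseudosphere *)

Section SphericalCurve.
Context {R : realType}.
Variables (J : set R) (l n : R -> 'rV[R]_4).
Hypotheses (hJ : open_interval J) (hl : unit_speed_on_S21 J l)
  (hn : unit_normal J l n).

Let l1 v : J v -> is_derive v 1 l (derive1 l v).
Proof. by case: hl => sl _ _; exact: (smooth_is_derive _ _ 0 _ sl). Qed.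

Let l2 v : J v -> is_derive v 1 (derive1 l) (derive1n 2 l v).
Proof. by case: hl => sl _ _; exact: (smooth_is_derive _ _ 1 _ sl). Qed.

(** Product rule for a constant inner product; it produces all the relations among l, l' and l''
    below. *)
Lemma inner_derive_eq (x y : R -> 'rV[R]_4) dx dy c v :
  (forall v, J v -> inner (x v) (y v) = c) -> J v ->
  is_derive v 1 x dx -> is_derive v 1 y dy ->
  inner dx (y v) + inner (x v) dy = 0.
Proof.
move=> xyc Jv hx hy; have [oJ _ _] := hJ.
have h := is_derive_inner _ _ _ _ _ hx hy.
exact: (is_derive_open_unique J _ _ _ _ _ oJ Jv xyc h (is_derive_cst c v 1)).
Qed.

Lemma E31_derive (x : R -> 'rV[R]_4) dx v :
  (forall v, J v -> E31 (x v)) -> J v -> is_derive v 1 x dx -> E31 dx.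
Proof.
move=> xE Jv hx; apply/E31P; have [oJ _ _] := hJ.
have h := is_derive_coord _ _ _ 0 3 hx.
apply: (is_derive_open_unique J _ _ _ _ _ oJ Jv _ h (is_derive_cst 0 v 1)).
by move=> w /xE /E31P.
Qed.

Lemma curve_E31 v : J v -> E31 (l v).
Proof. by case: hl => _ h _ /h []. Qed.

Lemma velocity_E31 v : J v -> E31 (derive1 l v).
Proof. by move=> Jv; exact: (E31_derive _ _ _ curve_E31 Jv (l1 v Jv)). Qed.

Lemma acceleration_E31 v : J v -> E31 (derive1n 2 l v).
Proof. by move=> Jv; exact: (E31_derive _ _ _ velocity_E31 Jv (l2 v Jv)). Qed.

Lemma inner_curve v : J v -> inner (l v) (l v) = 1.
Proof. by case: hl => _ h _ /h []. Qed.

Lemma inner_velocity v : J v -> inner (derive1 l v) (derive1 l v) = 1.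
Proof. by case: hl => _ _; apply. Qed.

Lemma inner_curve_velocity v : J v -> inner (l v) (derive1 l v) = 0.
Proof.
move=> Jv; have := inner_derive_eq _ _ _ _ _ _ inner_curve Jv (l1 v Jv) (l1 v Jv).
by rewrite (innerC (derive1 l v)) => h; lra.
Qed.

Lemma inner_acceleration_velocity v :
  J v -> inner (derive1n 2 l v) (derive1 l v) = 0.
Proof.
move=> Jv.
have := inner_derive_eq _ _ _ _ _ _ inner_velocity Jv (l2 v Jv) (l2 v Jv).
by rewrite (innerC (derive1 l v)) => h; lra.
Qed.

Lemma inner_acceleration_curve v : J v -> inner (derive1n 2 l v) (l v) = -1.
Proof.
move=> Jv.
have := inner_derive_eq _ _ _ _ _ _ inner_curve_velocity Jv (l1 v Jv) (l2 v Jv).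
by rewrite (innerC (l v)) (inner_velocity _ Jv) => h; lra.
Qed.

(** The difference of the two sides lies in E^3_1 and is orthogonal to l, l' and n, hence is zero.
    The minus sign before kappa comes from [inner (n v) (n v) = -1]. *)
Lemma frenet_acceleration v : J v ->
  derive1n 2 l v = - (spherical_curvature l n v *: n v) - l v.
Proof.
move=> Jv; have [_ /(_ v Jv)[nE nn nl nt]] := hn.
apply/eqP; rewrite -subr_eq0 opprD !opprK addrA; apply/eqP.
have := (inner_curve _ Jv, inner_velocity _ Jv, inner_curve_velocity _ Jv,
  inner_acceleration_curve _ Jv, inner_acceleration_velocity _ Jv).
move=> [[[[ll tt] lt] al] at'].
apply: (E31_orthogonal_eq0 (l v) (derive1 l v) (n v)) => //.
- exact: curve_E31.
- exact: velocity_E31.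
- have /E31P a3 := acceleration_E31 _ Jv; have /E31P l3 := curve_E31 _ Jv.
  move/E31P : nE => n3.
  by apply/E31P; rewrite !mxE a3 l3 n3; ring.
- by rewrite !innerE al nl ll; ring.
- by rewrite !innerE at' nt lt; ring.
- by rewrite !innerE nn (innerC (l v)) nl /spherical_curvature; ring.
Qed.
End SphericalCurve.

(** * First and second derivatives of the meridian surface *)

Section MeridianSurface.
Context {R : realType}.
Variables (I J : set R) (f g : R -> R) (l : R -> 'rV[R]_4).
Hypotheses (hI : open_interval I) (hJ : open_interval J)
  (f_smooth : smooth_on I f) (g_smooth : smooth_on I g)
  (hl : unit_speed_on_S21 J l).
Let e4 : 'rV[R]_4 := basis_vec R 3.

Lemma meridian_dirD q u v : I u -> J v ->
  dirD q (meridian_surface f g l) u v =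
  q.1 *: (derive1 f u *: l v + derive1 g u *: e4) +
  q.2 *: (f u *: derive1 l v).
Proof.
move=> Iu Jv; have [sl _ _] := hl.
have f1 := smooth_is_derive _ _ 0 _ f_smooth Iu.
have g1 := smooth_is_derive _ _ 0 _ g_smooth Iu.
have l1 := smooth_is_derive _ _ 0 _ sl Jv.
congr (_ *: _ + _ *: _); apply: is_derive_derive1.
  exact: is_deriveD (is_derive_scalel _ _ _ _ f1) (is_derive_scalel _ _ _ _ g1).
rewrite -[X in is_derive _ _ _ X]addr0.
exact: is_deriveD (is_deriveZ (f u) l1) (is_derive_cst (g u *: e4) v 1).
Qed.

Lemma meridian_dirD2 p q u v : I u -> J v ->
  dirD p (dirD q (meridian_surface f g l)) u v =
  (p.1 * q.1) *: (derive1n 2 f u *: l v + derive1n 2 g u *: e4) +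
  (p.1 * q.2 + p.2 * q.1) *: (derive1 f u *: derive1 l v) +
  (p.2 * q.2) *: (f u *: derive1n 2 l v).
Proof.
move=> Iu Jv; have [sl _ _] := hl; have [oI _ _] := hI; have [oJ _ _] := hJ.
have f1 := smooth_is_derive _ _ 0 _ f_smooth Iu.
have f2 := smooth_is_derive _ _ 1 _ f_smooth Iu.
have g2 := smooth_is_derive _ _ 1 _ g_smooth Iu.
have l1 := smooth_is_derive _ _ 0 _ sl Jv.
have l2 := smooth_is_derive _ _ 1 _ sl Jv.
have du : derive1 (fun s => dirD q (meridian_surface f g l) s v) u =
    q.1 *: (derive1n 2 f u *: l v + derive1n 2 g u *: e4) +
    q.2 *: (derive1 f u *: derive1 l v).
  apply: is_derive_derive1.
  (* The first-order formula is known on [I] only; since [I] is open, it may be differentiated at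
     [u]. *)
  apply: (is_derive_open_eq I _ _ _ _ oI Iu (fun s Is => meridian_dirD q s v Is Jv)).
  apply: is_deriveD (is_deriveZ _ _) (is_deriveZ _ (is_derive_scalel _ _ _ _ f1)).
  exact: is_deriveD (is_derive_scalel _ _ _ _ f2) (is_derive_scalel _ _ _ _ g2).
have dv : derive1 (fun s => dirD q (meridian_surface f g l) u s) v =
    q.1 *: (derive1 f u *: derive1 l v) + q.2 *: (f u *: derive1n 2 l v).
  apply: is_derive_derive1.
  apply: (is_derive_open_eq J _ _ _ _ oJ Jv (fun s Js => meridian_dirD q u s Iu Js)).
  apply: is_deriveD (is_deriveZ _ _) (is_deriveZ _ (is_deriveZ _ l2)).
  rewrite -[X in is_derive _ _ _ X]addr0.
  exact: is_deriveD (is_deriveZ _ l1) (is_derive_cst _ v 1).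
transitivity (p.1 *: (q.1 *: (derive1n 2 f u *: l v + derive1n 2 g u *: e4) +
    q.2 *: (derive1 f u *: derive1 l v)) +
  p.2 *: (q.1 *: (derive1 f u *: derive1 l v) + q.2 *: (f u *: derive1n 2 l v))).
  by rewrite -du -dv.
move: (derive1n 2 f u) (derive1n 2 g u) (derive1n 2 l v) => f'' g'' l''.
move: (derive1 f u) (derive1 l v) e4 => f' l' e.
by apply/rowP => i; rewrite !mxE; ring.
Qed.
End MeridianSurface.

(** For c = f(u) the hypotheses say that p and q form an orthonormal frame for the induced metric
    diag(-1, c^2) in the coordinates z_u, z_v. The conclusions say that p p^T - q q^T is the inverse
    metric, which makes the trace of h independent of the frame. *)
Lemma lorentz_frame_dual {F : fieldType} (c p1 p2 q1 q2 : F) : c != 0 ->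
  - p1 ^+ 2 + c ^+ 2 * p2 ^+ 2 = 1 -> - q1 ^+ 2 + c ^+ 2 * q2 ^+ 2 = -1 ->
  - (p1 * q1) + c ^+ 2 * (p2 * q2) = 0 ->
  [/\ p1 ^+ 2 - q1 ^+ 2 = -1, p1 * p2 = q1 * q2 &
      p2 ^+ 2 - q2 ^+ 2 = (c ^+ 2)^-1].
Proof.
move=> c0 pp qq pq.
(* d is the determinant of the frame in the orthonormal basis z_u, z_v / c; the
   equations make it a sign and, up to that sign, give q1 = c p2 and c q2 = p1. *)
pose d := c * (p1 * q2 - p2 * q1).
have dp : d * p1 = - (c * q2).
  transitivity (c * p2 * (- (p1 * q1) + c ^+ 2 * (p2 * q2))
    - c * q2 * (- p1 ^+ 2 + c ^+ 2 * p2 ^+ 2)); first by rewrite /d; ring.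
  by rewrite pp pq; ring.
have dcp : d * (c * p2) = - q1.
  transitivity (p1 * (- (p1 * q1) + c ^+ 2 * (p2 * q2))
    - q1 * (- p1 ^+ 2 + c ^+ 2 * p2 ^+ 2)); first by rewrite /d; ring.
  by rewrite pp pq; ring.
have d2 : d ^+ 2 = 1.
  transitivity ((- (p1 * q1) + c ^+ 2 * (p2 * q2)) ^+ 2
    - (- p1 ^+ 2 + c ^+ 2 * p2 ^+ 2) * (- q1 ^+ 2 + c ^+ 2 * q2 ^+ 2)).
    by rewrite /d; ring.
  by rewrite pp qq pq; ring.
have q1E : q1 = - (d * (c * p2)) by rewrite dcp opprK.
have cq2E : c * q2 = - (d * p1) by rewrite dp opprK.
have q11 : q1 ^+ 2 = c ^+ 2 * p2 ^+ 2.
  by rewrite q1E; transitivity (d ^+ 2 * (c ^+ 2 * p2 ^+ 2)); [ring|rewrite d2 mul1r].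
have q22 : c ^+ 2 * q2 ^+ 2 = p1 ^+ 2.
  rewrite -exprMn cq2E.
  by transitivity (d ^+ 2 * p1 ^+ 2); [ring|rewrite d2 mul1r].
split.
- by rewrite q11 -pp; ring.
- apply: (mulfI c0).
  transitivity (q1 * (c * q2)); last ring.
  rewrite q1E cq2E.
  by transitivity (d ^+ 2 * (c * (p1 * p2))); [rewrite d2; ring|ring].
- have c20 : c ^+ 2 != 0 by rewrite sqrf_eq0.
  apply: (mulfI c20); rewrite mulrBr q22 divff//.
  by rewrite -pp; ring.
Qed.

(** * Vanishing mean curvature as a condition on kappa and an equation for f *)

Section Minimality.
Context {R : realType}.
Variables (I J : set R) (f g : R -> R) (l n : R -> 'rV[R]_4).
Hypotheses (hI : open_interval I) (hJ : open_interval J)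
  (f_smooth : smooth_on I f) (g_smooth : smooth_on I g)
  (f_neq0 : forall u, I u -> f u <> 0)
  (fg_speed : forall u, I u -> derive1 f u ^+ 2 - derive1 g u ^+ 2 = -1)
  (hl : unit_speed_on_S21 J l) (hn : unit_normal J l n).
Let e4 : 'rV[R]_4 := basis_vec R 3.
Let z := meridian_surface f g l.
Let zu u v := derive1 f u *: l v + derive1 g u *: e4.
Let zv u v := f u *: derive1 l v.

Lemma inner_basis_vec33 : inner e4 e4 = -1.
Proof. by rewrite inner_basis_vec3 !mxE/=. Qed.

Lemma E31_inner_basis_vec3 (x : 'rV[R]_4) : E31 x -> inner x e4 = 0.
Proof. by rewrite inner_basis_vec3 => /E31P ->; rewrite oppr0. Qed.

Lemma speed_derive u : I u ->
  derive1 f u * derive1n 2 f u = derive1 g u * derive1n 2 g u.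
Proof.
move=> Iu; have [oI _ _] := hI.
have f2 := smooth_is_derive _ _ 1 _ f_smooth Iu.
have g2 := smooth_is_derive _ _ 1 _ g_smooth Iu.
have := is_derive_open_unique I _ _ _ _ _ oI Iu fg_speed
  (is_deriveB (is_deriveX 2 f2) (is_deriveX 2 g2)) (is_derive_cst (-1 : R) u 1).
rewrite -[2%N.-1]/1%N !expr1 /GRing.scale/= => h.
by lra.
Qed.

Lemma meridian_tangent u v : I u -> J v ->
  tangent z u v = span2 (zu u v) (zv u v).
Proof.
move=> Iu Jv; apply/seteqP.
by split=> w [p ->]; exists p; rewrite (meridian_dirD I J).
Qed.

Lemma meridian_metric u v : I u -> J v ->
  [/\ inner (zu u v) (zu u v) = -1, inner (zu u v) (zv u v) = 0 &
      inner (zv u v) (zv u v) = f u ^+ 2].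
Proof.
move=> Iu Jv; have le := E31_inner_basis_vec3 _ (curve_E31 _ _ hl _ Jv).
have l'e := E31_inner_basis_vec3 _ (velocity_E31 _ _ hJ hl _ Jv).
have ll := inner_curve _ _ hl _ Jv.
have ll' := inner_curve_velocity _ _ hJ hl _ Jv.
have l'l' := inner_velocity _ _ hl _ Jv.
rewrite /zu /zv !innerE !(innerC e4) inner_basis_vec33 le l'e ll ll' l'l'.
have fg := fg_speed _ Iu; split; [|ring|ring].
by transitivity (derive1 f u ^+ 2 - derive1 g u ^+ 2); [ring|].
Qed.

(* For every orthonormal frame, 2 H is the normal part of z_vv / f^2 - z_uu. *)
Lemma is_mean_curvature0P u v : I u -> J v ->
  is_mean_curvature z u v 0 <->
  span2 (zu u v) (zv u v) ((f u)^-1 *: derive1n 2 l v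
    - (derive1n 2 f u *: l v + derive1n 2 g u *: e4)).
Proof.
move=> Iu Jv; have [zuu zuv zvv] := meridian_metric _ _ Iu Jv.
have f0 : f u != 0 by apply/eqP/f_neq0.
have zvv0 : inner (zv u v) (zv u v) != 0 by rewrite zvv sqrf_eq0.
have frameP p q : orthonormal_frame z u v p q <->
  [/\ - p.1 ^+ 2 + f u ^+ 2 * p.2 ^+ 2 = 1,
      - q.1 ^+ 2 + f u ^+ 2 * q.2 ^+ 2 = -1 &
      - (p.1 * q.1) + f u ^+ 2 * (p.2 * q.2) = 0].
  have h p' q' : inner (dirD p' z u v) (dirD q' z u v) =
      - (p'.1 * q'.1) + f u ^+ 2 * (p'.2 * q'.2).
    rewrite !(meridian_dirD I J)// -/(zu u v) -/(zv u v).
    move: (zuu) (zuv) (zvv); move: (zu u v) (zv u v) => x y xx xy yy.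
    by rewrite !innerE (innerC y) xx xy yy; ring.
  by rewrite /orthonormal_frame !h !expr2.
(* The frame z_v / f, z_u: it shows that the metric is Lorentzian, and it is the frame tested when H
   = 0 is assumed. *)
have frame0 : orthonormal_frame z u v (0, (f u)^-1) (1, 0).
  by apply/frameP; split=> /=; field.
have dirDB p q : orthonormal_frame z u v p q ->
    dirD p (dirD p z) u v - dirD q (dirD q z) u v =
    (f u)^-1 *: derive1n 2 l v
      - (derive1n 2 f u *: l v + derive1n 2 g u *: e4).
  move=> /frameP[pp qq pq].
  have [e1 e12 e2] := lorentz_frame_dual _ _ _ _ _ f0 pp qq pq.
  rewrite !(meridian_dirD2 I J)// -/e4.
  move: (derive1n 2 f u) (derive1n 2 g u) (derive1n 2 l v) => f'' g'' l''.
  move: (derive1 f u) (derive1 l v) e4 => f' l' e.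
  (* The three terms are multiples of z_uu, z_uv and z_vv, with z_uv counted twice; the frame
     identities cancel the middle one. *)
  transitivity ((p.1 ^+ 2 - q.1 ^+ 2) *: (f'' *: l v + g'' *: e) +
      ((p.1 * p.2 - q.1 * q.2) *+ 2) *: (f' *: l') +
      (p.2 ^+ 2 - q.2 ^+ 2) *: (f u *: l'')).
    by apply/rowP => i; rewrite !mxE; ring.
  rewrite e1 e2 e12 subrr mul0rn scale0r addr0 scaleN1r scalerA expr2 invfM.
  by rewrite divfK// addrC.
rewrite /is_mean_curvature /second_ff (meridian_tangent _ _ Iu Jv).
split=> [[_ /(_ _ _ frame0)/esym/eqP]|hspan].
  rewrite scaler_eq0 invr_eq0 pnatr_eq0/= subr_eq0 => /eqP.
  by move/(normal_part_eq _ _ _ _ zuu zuv zvv0); rewrite dirDB.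
split=> [|p q pq]; first by exists (0, (f u)^-1), (1, 0).
apply/esym/eqP; rewrite scaler_eq0 invr_eq0 pnatr_eq0/= subr_eq0; apply/eqP.
by apply/(normal_part_eq _ _ _ _ zuu zuv zvv0); rewrite dirDB.
Qed.

(** Pairing the tangent vector w with the two normal directions gives kappa = 0 and a relation
    between f and g. Conversely, under the two conditions w is an explicit multiple of z_u. *)
Lemma is_mean_curvature0_ode u v : I u -> J v ->
  is_mean_curvature z u v 0 <->
  spherical_curvature l n v = 0 /\
  f u * derive1n 2 f u + derive1 f u ^+ 2 + 1 = 0.
Proof.
move=> Iu Jv; rewrite is_mean_curvature0P//.
have f0 : f u != 0 by apply/eqP/f_neq0.
have g1E : derive1 g u ^+ 2 = derive1 f u ^+ 2 + 1 by have := fg_speed _ Iu; lra.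
have g0 : derive1 g u != 0.
  by rewrite -sqrf_eq0 g1E gt_eqF// ltr_wpDl// sqr_ge0.
have fg2 := speed_derive _ Iu.
split=> [hspan|[k0 ode]].
  have [_ /(_ v Jv)[nE nn nl nl']] := hn.
  have le := E31_inner_basis_vec3 _ (curve_E31 _ _ hl _ Jv).
  have l'e := E31_inner_basis_vec3 _ (velocity_E31 _ _ hJ hl _ Jv).
  have l''e := E31_inner_basis_vec3 _ (acceleration_E31 _ _ hJ hl _ Jv).
  have ne := E31_inner_basis_vec3 _ nE.
  have ll := inner_curve _ _ hl _ Jv.
  have ll' := inner_curve_velocity _ _ hJ hl _ Jv.
  have l''l := inner_acceleration_curve _ _ hJ hl _ Jv.
  split.
    have : inner ((f u)^-1 *: derive1n 2 l v
        - (derive1n 2 f u *: l v + derive1n 2 g u *: e4)) (n v) = 0.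
      apply: span2_normal hspan _ _ _.
        by rewrite /zu !innerE (innerC (l v)) (innerC e4) nl ne; ring.
      by rewrite /zv innerE (innerC (derive1 l v)) nl' mulr0.
    rewrite !innerE (innerC (l v)) (innerC e4) nl ne -/(spherical_curvature l n v).
    rewrite !mulr0 addr0 oppr0 addr0 => /eqP.
    by rewrite mulf_eq0 invr_eq0 (negbTE f0) => /eqP.
  (* The second normal direction, besides n, is g' l + f' e_4. *)
  have : inner ((f u)^-1 *: derive1n 2 l v
      - (derive1n 2 f u *: l v + derive1n 2 g u *: e4))
      (derive1 g u *: l v + derive1 f u *: e4) = 0.
    apply: span2_normal hspan _ _ _.
      by rewrite /zu !innerE !(innerC e4) le ll inner_basis_vec33; ring.
    by rewrite /zv !innerE (innerC (derive1 l v)) ll' l'e; ring.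
  rewrite !innerE !(innerC e4) le ll l''l l''e inner_basis_vec33 => h.
  move: h fg2 g1E.
  move: (derive1n 2 f u) (derive1n 2 g u) (derive1 f u) (derive1 g u) (f u) f0.
  move=> f2 g2 f1 g1 F F0 h fg2 g1E.
  have {}h : F * (g2 * f1 - f2 * g1) - g1 = 0.
    by rewrite -[RHS](mulr0 F) -h; field.
  (* The factor g' allows g'' to be eliminated through g' g'' = f' f'', after which g'^2 = f'^2 + 1
     leaves an equation in f alone. *)
  transitivity (- (g1 * (F * (g2 * f1 - f2 * g1) - g1))).
    transitivity (- (F * (f1 * (f1 * f2) - f2 * g1 ^+ 2) - g1 ^+ 2)).
      by rewrite g1E; ring.
    by rewrite fg2; ring.
  by rewrite h mulr0 oppr0.
rewrite (frenet_acceleration _ _ _ hJ hl hn _ Jv) k0 scale0r oppr0 add0r.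
(* Now l'' = - l, so w = - (1/f + f'') l - g'' e_4. Comparing the e_4 components with z_u = f' l +
   g' e_4 forces the factor - g''/g'; [e1] checks the l components. *)
exists (- (derive1n 2 g u / derive1 g u), 0).
rewrite scale0r addr0 /zu.
have e1 : (f u)^-1 + derive1n 2 f u =
    derive1n 2 g u / derive1 g u * derive1 f u.
  have g2E : (derive1 f u ^+ 2 + 1) / f u = - derive1n 2 f u.
    apply: (mulIf f0); rewrite divfK//; lra.
  have g20 : derive1 g u ^+ 2 != 0 by rewrite sqrf_eq0.
  (* After multiplication by g'^2 = f'^2 + 1, both sides equal f'^2 f''. *)
  apply: (mulIf g20); transitivity (derive1 f u * (derive1 f u * derive1n 2 f u)).
    rewrite mulrDl g1E mulrC g2E; ring.
  by rewrite fg2; field.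
have e2 : derive1n 2 g u = derive1n 2 g u / derive1 g u * derive1 g u.
  by rewrite divfK.
rewrite scalerDr !scalerA !mulNr -e1 -e2 scaleNr scalerDl scaleNr.
by rewrite scalerN !opprD !addrA.
Qed.
End Minimality.

(** * Integration of the equation of the meridian curve *)

Section MeridianODE.
Context {R : realType}.
Variables (I : set R) (f g : R -> R).
Hypotheses (hI : open_interval I)
  (f_smooth : smooth_on I f) (g_smooth : smooth_on I g)
  (f_neq0 : forall u, I u -> f u <> 0)
  (fg_speed : forall u, I u -> derive1 f u ^+ 2 - derive1 g u ^+ 2 = -1).

Let f1 u : I u -> is_derive u 1 f (derive1 f u).
Proof. exact: (smooth_is_derive _ _ 0 _ f_smooth). Qed.

Let f2 u : I u -> is_derive u 1 (derive1 f) (derive1n 2 f u).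
Proof. exact: (smooth_is_derive _ _ 1 _ f_smooth). Qed.

Let g1 u : I u -> is_derive u 1 g (derive1 g u).
Proof. exact: (smooth_is_derive _ _ 0 _ g_smooth). Qed.

(** Differentiating the quadratic and halving gives f f' = a - u; differentiating once more gives
    the equation. *)
Lemma sqr_quadratic_ode a b :
  (forall u, I u -> f u ^+ 2 = - u ^+ 2 + 2 * a * u + b) ->
  forall u, I u -> f u * derive1n 2 f u + derive1 f u ^+ 2 + 1 = 0.
Proof.
have [oI _ _] := hI => fE.
have ff1 u : I u -> f u * derive1 f u = a - u.
  move=> Iu.
  have := is_derive_open_unique I (f ^+ 2)
    (- (id : R -> R) ^+ 2 + (2 * a) *: (id : R -> R) + cst b) _ _ _ oI Iu fE
    (is_deriveX 2 (f1 _ Iu))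
    (is_deriveD (is_deriveD (is_deriveN (is_deriveX 2 (is_derive_id u 1)))
       (is_deriveZ (2 * a) (is_derive_id u 1))) (is_derive_cst b u 1)).
  rewrite -[2%N.-1]/1%N !expr1 /GRing.scale/= => h.
  by lra.
move=> u Iu.
have := is_derive_open_unique I (f * derive1 f) (cst a - (id : R -> R)) _ _ _
  oI Iu ff1 (is_deriveM (f1 _ Iu) (f2 _ Iu))
  (is_deriveB (is_derive_cst a u 1) (is_derive_id u 1)).
rewrite /GRing.scale/= => h.
by lra.
Qed.

(** Two successive first integrals: the equation makes f f' + u a constant a, and then f^2 + u^2 - 2
    a u is a constant b. *)
Lemma ode_sqr_quadratic :
  (forall u, I u -> f u * derive1n 2 f u + derive1 f u ^+ 2 + 1 = 0) ->
  exists a b, forall u, I u ->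
    f u * derive1 f u = a - u /\ f u ^+ 2 = - u ^+ 2 + 2 * a * u + b.
Proof.
have [_ iI [u0 Iu0]] := hI => ode.
pose k := f * derive1 f + (id : R -> R).
have kE u : I u -> k u = k u0.
  move=> Iu; apply: (derive0_interval I) => // t It.
  apply: is_derive_eq.
    exact: is_deriveD (is_deriveM (f1 _ It) (f2 _ It)) (is_derive_id t 1).
  by have := ode t It; rewrite /GRing.scale/= => h; lra.
set a := k u0 in kE.
have ff1 u : I u -> f u * derive1 f u = a - u.
  by move=> /kE <-; rewrite /k fctE/= addrK.
pose m := f ^+ 2 + (id : R -> R) ^+ 2 - (2 * a) *: (id : R -> R).
have mE u : I u -> m u = m u0.
  move=> Iu; apply: (derive0_interval I) => // t It.
  apply: is_derive_eq.
    exact: is_deriveB (is_deriveD (is_deriveX 2 (f1 _ It))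
      (is_deriveX 2 (is_derive_id t 1))) (is_deriveZ (2 * a) (is_derive_id t 1)).
  rewrite -[2%N.-1]/1%N !expr1.
  by have := ff1 t It; rewrite /GRing.scale/= => h; lra.
exists a, (m u0) => u Iu; split; first exact: ff1.
rewrite -(mE _ Iu) /m !fctE /GRing.scale/=; ring.
Qed.

(** The strict bound keeps the argument inside ]-1, 1[, where [asin] is differentiable; the factor
    1/r of the chain rule is absorbed into the square root. *)
Lemma is_derive_asin_affine (a r u : R) : 0 < r -> (u - a) ^+ 2 < r ^+ 2 ->
  is_derive u 1 (fun t => asin ((t - a) / r))
    (Num.sqrt (r ^+ 2 - (u - a) ^+ 2))^-1.
Proof.
move=> r0 ur.
have rE : r != 0 by rewrite gt_eqF.
have ur1 : -1 < (u - a) / r < 1.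
  rewrite -ltr_norml normrM normfV (gtr0_norm r0) ltr_pdivrMr// mul1r.
  by rewrite -(ltr_pXn2r (n := 2))// ?nnegrE// ?ltW// real_normK// num_real.
have hin : is_derive u 1 (fun t : R => (t - a) / r) r^-1.
  have -> : (fun t : R => (t - a) / r) = r^-1 *: ((id : R -> R) - cst a).
    by apply/funext => t; rewrite !fctE /GRing.scale/= mulrC.
  apply: is_derive_eq.
  by rewrite /GRing.scale/= subr0 mulr1.
apply: (is_derive_eq (@is_derive1_comp _ (@asin R) (fun t => (t - a) / r)
  _ _ _ (is_derive1_asin ur1) hin)).
have -> : r ^+ 2 - (u - a) ^+ 2 = r ^+ 2 * (1 - ((u - a) / r) ^+ 2) by field.
by rewrite sqrtrM ?sqr_ge0// sqrtr_sqr gtr0_norm// invfM mulrC.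
Qed.

(** Completing the square gives r^2 - (u - a)^2 = f^2, so the arcsine has derivative 1/|f|, while
    |g'| = r/|f|. As g' keeps a constant sign, g and the signed multiple of the arcsine differ by a
    constant. *)
Lemma asin_primitive a b :
  (forall u, I u -> f u * derive1 f u = a - u /\
     f u ^+ 2 = - u ^+ 2 + 2 * a * u + b) ->
  exists C (s2 : bool), forall u, I u ->
    g u = (-1) ^+ s2 * Num.sqrt (a ^+ 2 + b)
            * asin ((u - a) / Num.sqrt (a ^+ 2 + b)) + C.
Proof.
have [_ iI [u0 Iu0]] := hI => fE.
set r := Num.sqrt (a ^+ 2 + b).
have f20 u : I u -> 0 < f u ^+ 2 by move=> /f_neq0/eqP; rewrite exprn_even_gt0.
have rf' u : I u -> a ^+ 2 + b = f u ^+ 2 + (u - a) ^+ 2.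
  by move=> /fE[_ ->]; ring.
(* A single point with f nonzero makes the radius positive. *)
have ab0 : 0 < a ^+ 2 + b by rewrite (rf' _ Iu0) ltr_wpDr ?sqr_ge0 ?f20.
have r0 : 0 < r by rewrite sqrtr_gt0.
have rf u : I u -> r ^+ 2 - (u - a) ^+ 2 = f u ^+ 2.
  by move=> Iu; rewrite sqr_sqrtr ?ltW// (rf' _ Iu) addrK.
have gE u : I u -> `|derive1 g u| = r / `|f u|.
  move=> Iu; have fu0 : f u != 0 by apply/eqP/f_neq0.
  have [ff _] := fE _ Iu.
  apply: (mulIf (x := `|f u|)); first by rewrite normr_eq0.
  rewrite divfK ?normr_eq0// -normrM -(gtr0_norm r0).
  (* Compared through squares: r^2 = f^2 + (u - a)^2 = f^2 + (f f')^2 = f^2 g'^2. *)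
  apply/eqP; rewrite eqr_norm2 -eqf_sqr; apply/eqP.
  rewrite sqr_sqrtr ?ltW// (rf' _ Iu) exprMn -[u - a]opprB -ff sqrrN exprMn.
  have -> : derive1 g u ^+ 2 = 1 + derive1 f u ^+ 2.
    by have := fg_speed _ Iu; lra.
  by ring.
have g1_neq0 u : I u -> derive1 g u <> 0.
  move=> Iu g0; have := gE _ Iu; rewrite g0 normr0 => /esym/eqP.
  rewrite mulf_eq0 invr_eq0 normr_eq0 (gt_eqF r0)/= => /eqP.
  exact: f_neq0.
have dg1 u : I u -> derivable (derive1 g) u 1 by exact: (g_smooth 1).
have [s2 gs] := nonvanishing_sign I (derive1 g) iI dg1 g1_neq0.
pose G := ((-1) ^+ s2 * r) *: (fun t => asin ((t - a) / r)).
exists (g u0 - G u0), s2 => u Iu.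
suff : g u - G u = g u0 - G u0 by move=> <-; rewrite addrC subrK.
suff : (g - G) u = (g - G) u0 by [].
apply: (derive0_interval I) => // t It; apply: is_derive_eq.
  apply: is_deriveB (g1 _ It) (is_deriveZ _ (is_derive_asin_affine _ _ _ r0 _)).
  by rewrite -subr_gt0 rf// f20.
by rewrite rf// sqrtr_sqr gs// gE// /GRing.scale/=; ring.
Qed.

(** Once f^2 is the quadratic, f is its square root up to the constant sign of f, and
    [asin_primitive] supplies g. Conversely, squaring the formula for f recovers the quadratic. *)
Lemma meridian_ode :
  (forall u, I u -> f u * derive1n 2 f u + derive1 f u ^+ 2 + 1 = 0) <->
  exists (a b C : R) (s1 s2 : bool), forall u : R, I u ->
     f u = (-1) ^+ s1 * Num.sqrt (- u ^+ 2 + 2 * a * u + b) /\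
     g u = (-1) ^+ s2 * Num.sqrt (a ^+ 2 + b)
             * asin ((u - a) / Num.sqrt (a ^+ 2 + b)) + C.
Proof.
split=> [/ode_sqr_quadratic[a [b fE]]|[a [b [C [s1 [s2 fgE]]]]]].
  have [_ iI _] := hI.
  have [C [s2 gE]] := asin_primitive _ _ fE.
  have [s1 fs] := nonvanishing_sign I f iI (f_smooth 0) f_neq0.
  exists a, b, C, s1, s2 => u Iu; split; last exact: gE.
  by have [_ <-] := fE _ Iu; rewrite sqrtr_sqr -fs.
apply: (sqr_quadratic_ode a b) => u Iu; have [fE _] := fgE _ Iu.
(* Num.sqrt is 0 on negative numbers, which f_neq0 excludes. *)
rewrite fE exprMn sqrr_sign mul1r sqr_sqrtr// leNgt; apply/negP => q0.
by apply: (f_neq0 _ Iu); rewrite fE ltr0_sqrtr// mulr0.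
Qed.
End MeridianODE.

Theorem theorem1 (R : realType) (I J : set R) (f g : R -> R)
    (l n : R -> 'rV[R]_4)
    (hI : open_interval I) (hJ : open_interval J)
    (f_smooth : smooth_on I f) (g_smooth : smooth_on I g)
    (f_neq0 : forall u : R, I u -> f u <> 0)
    (fg_speed : forall u : R, I u -> derive1 f u ^+ 2 - derive1 g u ^+ 2 = -1)
    (hl : unit_speed_on_S21 J l) (hn : unit_normal J l n) :
  minimal I J (meridian_surface f g l) <->
  (forall v : R, J v -> spherical_curvature l n v = 0) /\
  (exists (a b C : R) (s1 s2 : bool), forall u : R, I u ->
     f u = (-1) ^+ s1 * Num.sqrt (- u ^+ 2 + 2 * a * u + b) /\
     g u = (-1) ^+ s2 * Num.sqrt (a ^+ 2 + b)
             * asin ((u - a) / Num.sqrt (a ^+ 2 + b)) + C).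
Proof.
have [_ _ [u0 Iu0]] := hI; have [_ _ [v0 Jv0]] := hJ.
rewrite -meridian_ode//.
have H0P u v := is_mean_curvature0_ode I J f g l n hI hJ f_smooth g_smooth
  f_neq0 fg_speed hl hn u v.
split=> [min|[k0 ode] u v Iu Jv]; last first.
  by apply/H0P => //; split; [exact: k0|exact: ode].
(* The curvature condition involves v only and the equation u only, so each is read off with the
   other variable frozen at a base point. *)
split=> [v Jv|u Iu].
  by have [] := (H0P _ _ Iu0 Jv).1 (min _ _ Iu0 Jv).
by have [] := (H0P _ _ Iu Jv0).1 (min _ _ Iu Jv0).
Qed.
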